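(* (Intuitionistic logic.) Let $a,b\in\mathbb Q$, let $A$ be a type and $(q_\alpha)_{\alpha:A},(r_\alpha)_{\alpha:A}$ families of rational numbers satisfying CovL. Then there exist $n\in\mathbb N$ and $F:[n]\to A$ such that $[a,b]_{\mathrm{cut}}\subseteq\mathop{\boxplus}_{i:[n]}(q_{F(i)},r_{F(i)})_{\mathrm{cut}}$.
   Context: All in intuitionistic logic, with an impredicative type of propositions. A lowercut is $L\subseteq\mathbb Q$ that is a lower set ($a<b\wedge b\in L\to a\in L$) and upwards-open ($a\in L\to\exists b,(a<b\wedge b\in L)$); an uppercut is $U\subseteq\mathbb Q$ that is an upper set ($a<b\wedge a\in U\to b\in U$) and downwards-open ($b\in U\to\exists a,(a<b\wedge a\in U)$). A cut is a pair $x=(L,U)$ of a lowercut and an uppercut with $\forall a,b,(a\in L\wedge b\in U\to a<b)$; $\mathfrak I$ is the type of cuts. For a lowercut $L$, $\overline L:=\{q\mid\forall r,(r<q\to r\in L)\}$; for an uppercut $U$, $\overline U:=\{q\mid\forall r,(q<r\to r\in U)\}$. For $x=(L,U)$ and $q\in\mathbb Q$: $q<x:\Leftrightarrow q\in L$, $q\le x:\Leftrightarrow q\in\overline L$, $x<q:\Leftrightarrow q\in U$, $x\le q:\Leftrightarrow q\in\overline U$. A complemented subset of $X$ is a pair $V=(V^+,V^-)$ of subsets with $x\in V^+\to x\notin V^-$. Inclusion: $V\subseteq W$ iff $V^+\subseteq W^+$ and $W^-\subseteq V^-$. Multiplicative union: $V\boxplus W:=(\{x\mid(x\in V^-\to x\in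 W^+)\wedge(x\in W^-\to x\in V^+)\},\ V^-\cap W^-)$; the finite version $\mathop{\boxplus}_{i:[n]}$ is defined inductively (empty one $(\emptyset,X)$). For $a,b\in\mathbb Q$: $[a,b]_{\mathrm{cut}}:=(\{x:\mathfrak I\mid a\le x\wedge x\le b\},\{x\mid(a\le x\to b<x)\wedge(x\le b\to x<a)\})$ and $(a,b)_{\mathrm{cut}}:=(\{x\mid a<x\wedge x<b\},\{x\mid(a<x\to b\le x)\wedge(x<b\to x\le a)\})$. CovL (for $a,b,q,r$): for every lowercut $L$, if $q_\alpha\in L\to r_\alpha\in\overline L$ holds for all $\alpha:A$, then $a\in\overline L\to b\in L$. *)

(* Defs.v *)
(* Subsets are Prop-valued predicates: the logic is the intuitionistic one of the
   impredicative sort Prop, and no axiom is imported. *)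
From mathcomp Require Import all_boot all_order all_algebra.
Set Implicit Arguments.
Unset Strict Implicit.
Unset Printing Implicit Defensive.
Local Open Scope ring_scope.

Record lowercut := Lowercut {
  inL :> rat -> Prop;
  lowercut_lower : forall a b : rat, a < b -> inL b -> inL a;
  lowercut_open : forall a : rat, inL a -> exists b : rat, a < b /\ inL b }.

Record uppercut := Uppercut {
  inU :> rat -> Prop;
  uppercut_upper : forall a b : rat, a < b -> inU a -> inU b;
  uppercut_open : forall b : rat, inU b -> exists a : rat, a < b /\ inU a }.

Definition closureL (L : lowercut) (q : rat) : Prop :=
  forall r : rat, r < q -> L r.

Definition closureU (U : uppercut) (q : rat) : Prop :=
  forall r : rat, q < r -> U r.

(* Neither locatedness nor inhabitedness is required. *)
Record cut := Cut {
  lower : lowercut;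
  upper : uppercut;
  cut_lt : forall a b : rat, lower a -> upper b -> a < b }.

Definition rat_lt_cut (q : rat) (x : cut) : Prop := lower x q.
Definition rat_le_cut (q : rat) (x : cut) : Prop := closureL (lower x) q.
Definition cut_lt_rat (x : cut) (q : rat) : Prop := upper x q.
Definition cut_le_rat (x : cut) (q : rat) : Prop := closureU (upper x) q.

Record complemented (X : Type) := Complemented {
  pos : X -> Prop;
  neg : X -> Prop;
  pos_not_neg : forall x : X, pos x -> ~ neg x }.

Definition csubset (X : Type) (V W : complemented X) : Prop :=
  (forall x, pos V x -> pos W x) /\ (forall x, neg W x -> neg V x).

Lemma cempty_subproof (X : Type) (x : X) : False -> ~ True.
Proof. by []. Qed.

Definition cempty (X : Type) : complemented X :=
  @Complemented X (fun=> False) (fun=> True) (@cempty_subproof X).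

Lemma mulunion_subproof (X : Type) (V W : complemented X) (x : X) :
  (neg V x -> pos W x) /\ (neg W x -> pos V x) -> ~ (neg V x /\ neg W x).
Proof. by move=> [VW _] [nV nW]; apply: (pos_not_neg (VW nV) nW). Qed.

Definition mulunion (X : Type) (V W : complemented X) : complemented X :=
  @Complemented X
    (fun x => (neg V x -> pos W x) /\ (neg W x -> pos V x))
    (fun x => neg V x /\ neg W x)
    (@mulunion_subproof X V W).

(* A right fold:
   V 0 [+] (V 1 [+] (... [+] (V (n - 1) [+] cempty))). *)
Definition bigmulunion (X : Type) (n : nat) (V : 'I_n -> complemented X) :
  complemented X := \big[@mulunion X/cempty X]_(i < n) V i.

Lemma rat_lt_cut_le_rat (x : cut) (q : rat) :
  rat_lt_cut q x -> ~ cut_le_rat x q.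
Proof.
move=> /lowercut_open[r [qr xr]] xq.
by have := cut_lt xr (xq r qr); rewrite Order.POrderTheory.ltxx.
Qed.

Lemma rat_le_cut_lt_rat (x : cut) (q : rat) :
  rat_le_cut q x -> ~ cut_lt_rat x q.
Proof.
move=> qx /uppercut_open[r [rq xr]].
by have := cut_lt (qx r rq) xr; rewrite Order.POrderTheory.ltxx.
Qed.

Lemma cut_closed_itv_subproof (a b : rat) (x : cut) :
  rat_le_cut a x /\ cut_le_rat x b ->
  ~ ((rat_le_cut a x -> rat_lt_cut b x) /\ (cut_le_rat x b -> cut_lt_rat x a)).
Proof. by move=> [ax xb] [/(_ ax) bx _]; apply: (rat_lt_cut_le_rat bx xb). Qed.

Definition cut_closed_itv (a b : rat) : complemented cut :=
  @Complemented cut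
    (fun x => rat_le_cut a x /\ cut_le_rat x b)
    (fun x => (rat_le_cut a x -> rat_lt_cut b x) /\
              (cut_le_rat x b -> cut_lt_rat x a))
    (@cut_closed_itv_subproof a b).

Lemma cut_open_itv_subproof (a b : rat) (x : cut) :
  rat_lt_cut a x /\ cut_lt_rat x b ->
  ~ ((rat_lt_cut a x -> rat_le_cut b x) /\ (cut_lt_rat x b -> cut_le_rat x a)).
Proof. by move=> [ax xb] [/(_ ax) bx _]; apply: (rat_le_cut_lt_rat bx xb). Qed.

Definition cut_open_itv (a b : rat) : complemented cut :=
  @Complemented cut
    (fun x => rat_lt_cut a x /\ cut_lt_rat x b)
    (fun x => (rat_lt_cut a x -> rat_le_cut b x) /\
              (cut_lt_rat x b -> cut_le_rat x a))
    (@cut_open_itv_subproof a b).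

Definition CovL (a b : rat) (A : Type) (q r : A -> rat) : Prop :=
  forall L : lowercut,
    (forall alpha : A, L (q alpha) -> closureL L (r alpha)) ->
    closureL L a -> L b.

(* Main.v *)
Require Import Defs.
From mathcomp Require Import all_boot all_order all_algebra.
Import Order.TTheory GRing.Theory Num.Theory.

(** Call a list [alpha_1, ..., alpha_n] a chain from [a] to [p] when
    [q alpha_1 < a], [q alpha_(i+1) < r alpha_i] and [p < r alpha_n] (and
    [p < a] if [n = 0]).  The rationals reachable from [a] by a chain form a
    lowercut satisfying the hypotheses of CovL, hence there is a chain from
    [a] to [b].  The intervals of a chain cover: given [a <= x], being in the
    complement of the first interval forces [r alpha_1 <= x], and one proceeds
    by induction along the chain. *)

Fixpoint chain (A : Type) (q r : A -> rat) (l : seq A) (a p : rat) : Prop :=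
  if l is alpha :: l' then (q alpha < a)%R /\ chain A q r l' (r alpha) p
  else (p < a)%R.

Section Chain.

Variables (A : Type) (q r : A -> rat).
Local Open Scope ring_scope.

Lemma chain_lower (l : seq A) (a p p' : rat) :
  p < p' -> chain A q r l a p' -> chain A q r l a p.
Proof.
move=> pp'; elim: l a => [|alpha l IHl] a /=; first exact: lt_trans.
by move=> [qa /IHl].
Qed.

Lemma chain_open (l : seq A) (a p : rat) :
  chain A q r l a p -> exists p', p < p' /\ chain A q r l a p'.
Proof.
elim: l a => [|alpha l IHl] a /= => [pa|[qa /IHl[p' [pp' lp']]]].
  by exists ((p + a) / 2%:R); rewrite !midf_lt.
by exists p'.
Qed.

(** [chain] unfolds from its left end, whereas closing the reachable rationals under the cover takes
    one more interval at the right end. *)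
Lemma chain_rcons (l : seq A) (alpha : A) (a p : rat) :
  chain A q r l a (q alpha) -> p < r alpha -> chain A q r (rcons l alpha) a p.
Proof.
move=> + pr; elim: l a => [|beta l IHl] a //=.
by move=> [qa /IHl].
Qed.

Lemma reachable_lower (a p p' : rat) :
  p < p' -> (exists l, chain A q r l a p') -> exists l, chain A q r l a p.
Proof. by move=> pp' [l lp']; exists l; apply: chain_lower lp'. Qed.

Lemma reachable_open (a p : rat) : (exists l, chain A q r l a p) ->
  exists p', p < p' /\ exists l, chain A q r l a p'.
Proof. by move=> [l /chain_open[p' [pp' lp']]]; exists p'; split=> //; exists l. Qed.

Definition reachable (a : rat) : lowercut :=
  Lowercut (reachable_lower a) (reachable_open a).

Lemma CovL_chain (a b : rat) : CovL a b q r -> exists l, chain A q r l a b.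
Proof.
move=> /(_ (reachable a)); apply=> [alpha [l lq] p pr|p pa]; last by exists [::].
by exists (rcons l alpha); apply: chain_rcons.
Qed.

Lemma cut_closed_itv_csubset_empty (a b : rat) :
  b < a -> csubset (cut_closed_itv a b) (cempty cut).
Proof.
move=> ba; split=> x /= => [[ax xb]|_]; last by split=> [/(_ _ ba)|/(_ _ ba)].
(* The midpoint of [b] and [a] would lie both below and above [x]. *)
have [bc ca] := midf_lt ba.
by have := cut_lt (ax _ ca) (xb _ bc); rewrite ltxx.
Qed.

(** As [c < a], a cut with [a <= x] has [c < x]; if it is in the negative part of [(c, d)], then
    [d <= x], so only [[d, b]] is left to [W]. *)
Lemma cut_closed_itv_csubset_mulunion (a b c d : rat) (W : complemented cut) :
  c < a -> csubset (cut_closed_itv d b) W ->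
  csubset (cut_closed_itv a b) (mulunion (cut_open_itv c d) W).
Proof.
move=> ca [posW negW]; split=> x /= => [[ax xb]|[[cx xd] /negW[/= dx xd']]].
  split=> [[cx _]|/negW[_ xd]]; last by split; [apply: ax | apply: xd].
  by apply: posW; split=> //; apply/cx/ax.
(* From [a <= x] follow in turn [c < x], [d <= x], [b < x]; from [x <= b] follow [x < d], [x <= c],
   [x < a]. *)
by split=> [/(_ _ ca)/cx/dx|/xd'/xd/(_ _ ca)].
Qed.

Lemma chain_csubset (l : seq A) (a b : rat) : chain A q r l a b ->
  csubset (cut_closed_itv a b)
    (\big[@mulunion cut/cempty cut]_(alpha <- l)
       cut_open_itv (q alpha) (r alpha)).
Proof.
elim: l a => [|alpha l IHl] a /=.
  by rewrite big_nil; apply: cut_closed_itv_csubset_empty.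
move=> [qa /IHl lb]; rewrite big_cons.
exact: cut_closed_itv_csubset_mulunion.
Qed.

End Chain.

Theorem theorem37 (a b : rat) (A : Type) (q r : A -> rat)
    (hcov : CovL a b q r) :
  exists (n : nat) (F : 'I_n -> A),
    csubset (cut_closed_itv a b)
      (bigmulunion (fun i : 'I_n => cut_open_itv (q (F i)) (r (F i)))).
Proof.
have [l /chain_csubset lab] := CovL_chain A q r a b hcov.
exists (size l), (tnth (in_tuple l)).
by rewrite /bigmulunion; rewrite big_tnth in lab.
Qed.
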